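(* Let $G$ be a finite bipartite graph with parts of sizes $p$ and $q$ (first and second part respectively), and let $H$ be a finite bipartite graph with parts of sizes $r$ and $s$ (first and second part respectively). Let $\mu_1,\dots,\mu_{p+q}$ be the eigenvalues (with multiplicity) of the adjacency matrix of $G$ and $\lambda_1,\dots,\lambda_{r+s}$ the eigenvalues (with multiplicity) of the adjacency matrix of $H$. Then the characteristic polynomials of the even and odd subgraphs $\mathrm{E}(G,H)$ and $\mathrm{O}(G,H)$ of the weak direct product $G\times H$ satisfy $$P\bigl(\mathrm{E}(G,H);x\bigr)\,P\bigl(\mathrm{O}(G,H);x\bigr)=\prod_{j=1}^{p+q}\;\prod_{k=1}^{r+s}(x-\mu_j\lambda_k)$$ and $$P\bigl(\mathrm{E}(G,H);x\bigr)=x^{(p-q)(r-s)}\,P\bigl(\mathrm{O}(G,H);x\bigr).$$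
   Context: For a graph $\Gamma$, $P(\Gamma;x)$ denotes the (monic) characteristic polynomial $\det(xI-A)$ of its adjacency matrix $A$; for the graph with no vertices it equals $1$. The weak direct product $G\times H$ has vertices $(u,v)$ with $u$ a vertex of $G$ and $v$ a vertex of $H$, with $(u,v)$ adjacent to $(u',v')$ if and only if $u$ is adjacent to $u'$ in $G$ and $v$ is adjacent to $v'$ in $H$. For bipartite $G$ and $H$ with ordered parts, $\mathrm{E}(G,H)$ is the subgraph of $G\times H$ induced on the vertices $(u,v)$ such that $u$ and $v$ lie in corresponding parts (both in the first parts, or both in the second parts), and $\mathrm{O}(G,H)$ is the subgraph induced on the vertices $(u,v)$ such that $u$ and $v$ lie in opposite parts (one in the first part and the other in the second part). Thus $\mathrm{E}(G,H)$ has $pr+qs$ vertices and $\mathrm{O}(G,H)$ has $ps+qr$ vertices. The exponent $(p-q)(r-s)$ may be negative, in which case the second identity is read as an identity of rational functions (Laurent polynomials) in $x$. *)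

(* Defs.v *)
From HB Require Import structures.
From mathcomp Require Import all_boot all_order all_algebra.

Set Implicit Arguments.
Unset Strict Implicit.
Unset Printing Implicit Defensive.

Import GRing.Theory.
Local Open Scope ring_scope.

Record sgraph := SGraph {
  vertex :> finType;
  adj : rel vertex;
  adj_sym : symmetric adj;
  adj_irrefl : irreflexive adj }.

(* The vertices are indexed by their rank in the enumeration of the type. *)
Definition adjacency (F : nzRingType) (G : sgraph) : 'M[F]_#|G| :=
  \matrix_(i, j) (adj (enum_val i) (enum_val j))%:R.

Definition graph_poly (F : nzRingType) (G : sgraph) : {poly F} :=
  char_poly (adjacency F G).

(* [ev] lists the eigenvalues of A, each as often as its multiplicity as a
   root of the characteristic polynomial. *)
Definition eigenvalues_of (F : fieldType) (n m : nat) (A : 'M[F]_n)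
    (ev : 'I_m -> F) : Prop :=
  char_poly A = \prod_(i < m) ('X - (ev i)%:P).

(* The parts are ordered, and either of them may be empty. *)
Definition bipartition (G : sgraph) (A1 A2 : {set G}) : Prop :=
  [/\ A1 :|: A2 = [set: G],
      [disjoint A1 & A2]
    & forall u v : G, adj u v ->
        (u \in A1) && (v \in A2) || (u \in A2) && (v \in A1)].

Section WeakProduct.
Variables G H : sgraph.

Definition weak_adj : rel (G * H)%type :=
  fun x y => adj x.1 y.1 && adj x.2 y.2.

Lemma weak_adj_sym : symmetric weak_adj.
Proof. by move=> x y; rewrite /weak_adj adj_sym [adj x.2 _]adj_sym. Qed.

Lemma weak_adj_irrefl : irreflexive weak_adj.
Proof. by move=> x; rewrite /weak_adj adj_irrefl. Qed.

Definition weak_product : sgraph := SGraph weak_adj_sym weak_adj_irrefl.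

End WeakProduct.

Section Induced.
Variables (G : sgraph) (S : {set G}).

Definition induced_adj : rel {x : G | x \in S} :=
  fun x y => adj (val x) (val y).

Lemma induced_adj_sym : symmetric induced_adj.
Proof. by move=> x y; rewrite /induced_adj adj_sym. Qed.

Lemma induced_adj_irrefl : irreflexive induced_adj.
Proof. by move=> x; rewrite /induced_adj adj_irrefl. Qed.

Definition induced : sgraph := SGraph induced_adj_sym induced_adj_irrefl.

End Induced.

Definition even_subgraph (G H : sgraph) (A1 A2 : {set G}) (B1 B2 : {set H}) :
    sgraph :=
  @induced (weak_product G H)
    [set w : G * H | (w.1 \in A1) && (w.2 \in B1)
                  || (w.1 \in A2) && (w.2 \in B2)].

Definition odd_subgraph (G H : sgraph) (A1 A2 : {set G}) (B1 B2 : {set H}) :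
    sgraph :=
  @induced (weak_product G H)
    [set w : G * H | (w.1 \in A1) && (w.2 \in B2)
                  || (w.1 \in A2) && (w.2 \in B1)].

(* Main.v *)
Require Import Defs.
From HB Require Import structures.
From mathcomp Require Import all_boot all_order all_algebra.
From mathcomp Require Import fingroup perm mxtens ring.

(** Write the adjacency matrices of G and H in block form, with zero diagonal
blocks and off-diagonal blocks M, M^T and N, N^T, where M is p x q and N is
r x s, and let * be the Kronecker product.

Product identity. In a bipartite graph adjacent vertices lie in opposite
parts, so no edge of the weak product joins an even pair to an odd pair: the
product graph is the disjoint union of E(G,H) and O(G,H), and the left-hand
side is its characteristic polynomial ([graph_poly_even_odd]). The adjacency
matrix of the product is the Kronecker product of those of G and H
([graph_poly_weak_product]). The eigenvalues of a Kronecker product A * B are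
the products of eigenvalues ([char_poly_tens]). Its proof makes A block
triangular by peeling off one eigenvalue at a time, which is possible over any
field over which the characteristic polynomial splits. Each eigenvalue a of A
contributes det (X - a B) ([det_tens_split]), and this determinant is evaluated
by the same lemma, with B now in the role of A and a 1 x 1 second factor ([char_poly_scale_mx]).

Ratio identity. E(G,H) is bipartite with biadjacency matrix M * N. Exchanging
the parts of H turns E into O and N into N^T, so O(G,H) has biadjacency matrix
M * N^T ([graph_poly_even]). A Schur complement expresses the characteristic
polynomial of a bipartite graph with m x n biadjacency matrix Z as
X^(n - m) det (X^2 - Z Z^T), where n - m may be negative ([char_poly_bip]). For
E and O the Gram matrix Z Z^T is (M M^T) * (N N^T) and (M M^T) * (N^T N) respectively. With
U = (M M^T) * N and V = 1 * N^T these are U V and V U, so by Sylvester's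
identity ([det_scalar_sub_mulC]) their characteristic polynomials differ by a
power of the variable only. Collecting exponents gives
(p r + q s) - (p s + q r) = (p - q)(r - s) ([char_poly_bip_tens_swap]). *)

Set Implicit Arguments.
Unset Strict Implicit.
Unset Printing Implicit Defensive.

Import GRing.Theory.
Local Open Scope ring_scope.

(** * Eigenvalues of a Kronecker product *)
Lemma det_castmxB (R : comNzRingType) m n (e : m = n) (A B : 'M[R]_m) :
  \det (castmx (e, e) A - castmx (e, e) B) = \det (A - B).
Proof. by case: n / e; rewrite !castmx_id. Qed.

Lemma tens1_scalar (R : pzRingType) m n (x : R) :
  (1%:M : 'M_m) *t (x%:M : 'M_n) = x%:M.
Proof.
apply/matrixP => i j.
case: (mxtens_indexP i) => i0 i1; case: (mxtens_indexP j) => j0 j1.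
rewrite tensmxE !mxE (can_eq (@mxtens_indexK _ _)) xpair_eqE.
by case: eqP; case: eqP => _ _; rewrite ?mul1r ?mulr0 ?mul0r.
Qed.

(** The conjugating matrix comes with an explicit one-sided inverse, so that
the lemma applies over any commutative ring, polynomial rings included. *)
Lemma det_similar (R : comNzRingType) n (Q Q' X Y : 'M[R]_n) :
  Q *m Q' = 1%:M -> Q *m X = Y *m Q -> \det X = \det Y.
Proof.
move=> QQ' QX; have dQ : \det Q * \det Q' = 1 by rewrite -det_mulmx QQ' det1.
by rewrite -[LHS]mul1r -dQ mulrAC -det_mulmx QX det_mulmx -mulrA dQ mulr1.
Qed.

Lemma char_poly_similar (R : comNzRingType) n (Q Q' A B : 'M[R]_n) :
  Q *m Q' = 1%:M -> Q *m A = B *m Q -> char_poly A = char_poly B.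
Proof.
move=> QQ' QA; apply: (@det_similar _ _ (map_mx polyC Q) (map_mx polyC Q')).
  by rewrite -map_mxM QQ' map_mx1.
by rewrite mulmxBr mulmxBl scalar_mxC -!map_mxM QA.
Qed.

(** Complete a row v with v A = a v to a basis, placed in the rows of Q: the
extended row basis of v, seen as a matrix with one row, is invertible and its
first row is proportional to v. *)
Lemma root_char_poly_block (F : fieldType) n (A : 'M[F]_n.+1) (a : F) :
  root (char_poly A) a ->
  exists (Q : 'M[F]_n.+1) (u : 'cV[F]_n) (B : 'M[F]_n),
    Q \in unitmx /\ Q *m A = (block_mx a%:M 0 u B : 'M_(1 + n)) *m Q.
Proof.
rewrite -eigenvalue_root_char => /eigenvalueP [v vA v_neq0].
set Q := row_ebase v; have Qu : Q \in unitmx by apply: row_ebase_unit.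
have rv : \rank v = 1%N by rewrite rank_rV v_neq0.
have [c vE] : exists c, v = c *: row 0 Q.
  exists (col_ebase v 0 0).
  (* The left factor of the echelon form of a row is the 1 x 1 matrix c. *)
  rewrite -{1}[v]mulmx_ebase rv -/Q [col_ebase v]mx11_scalar mxE mulr1n.
  rewrite -mulmxA mul_scalar_mx; congr (_ *: _).
  rewrite rowE; congr (_ *m _); apply/rowP => j.
  by rewrite !mxE eqxx /= andbT eq_sym.
have c_neq0 : c != 0 by apply: contraNneq v_neq0 => c0; rewrite vE c0 scale0r.
have rowA : row 0 Q *m A = a *: row 0 Q.
  apply: (scalerI c_neq0); rewrite scalerA [c * a]mulrC -scalerA.
  by rewrite -vE -vA vE scalemxAl.
pose B : 'M_(1 + n) := Q *m A *m invmx Q.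
have row0B : row 0 B = a *: delta_mx 0 0.
  by rewrite !row_mul rowA -scalemxAl -row_mul mulmxV // row1.
have BQ : B *m Q = Q *m A by rewrite mulmxKV.
exists Q, (dlsubmx B), (drsubmx B); split=> //.
clearbody B; rewrite -BQ.
have -> : a%:M = ulsubmx B.
  apply/rowP => j; have /rowP/(_ (lshift n j)) := row0B.
  rewrite !mxE !ord1 lshift0 eqxx mulr1 mulr1n => <-.
  by congr (B _ _); apply: val_inj.
have -> : 0 = ursubmx B.
  apply/rowP => j; have /rowP/(_ (rshift 1 j)) := row0B.
  by rewrite !mxE /= mulr0 => <-; congr (B _ _); apply: val_inj.
by rewrite submxK.
Qed.

Lemma char_poly_lblock (R : comNzRingType) n1 n2
    (A : 'M[R]_n1) (U : 'M[R]_(n2, n1)) (B : 'M[R]_n2) :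
  char_poly (block_mx A 0 U B) = char_poly A * char_poly B.
Proof.
rewrite /char_poly /char_poly_mx map_block_mx map_mx0 scalar_mx_block.
by rewrite opp_block_mx add_block_mx subr0 det_lblock.
Qed.

Lemma det_tens_lblock (R : comNzRingType) n m (a : R)
    (u : 'cV[R]_n) (B : 'M[R]_n) (C D : 'M[R]_m) :
  \det (1%:M *t D - block_mx a%:M 0 u B *t C) =
  \det (D - a *: C) * \det (1%:M *t D - B *t C).
Proof.
rewrite [1%:M]scalar_mx_block !tens_block_mx.
rewrite det_castmxB opp_block_mx add_block_mx !tens0mx subr0.
by rewrite det_lblock !tens_scalar_mx det_castmxB scale1r.
Qed.

(** Formally, 1 * D - A * C is block triangular with diagonal blocks D - a C
once A is triangular with diagonal entries a. Target ring and matrices C, D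
stay arbitrary because the lemma is needed with C and D over the polynomial
ring, for two different choices. *)
Lemma det_tens_split (F : fieldType) (R : comNzRingType)
    (f : {rmorphism F -> R}) n (A : 'M[F]_n) (s : seq F) :
  char_poly A = \prod_(a <- s) ('X - a%:P) ->
  forall m (C D : 'M[R]_m),
  \det (1%:M *t D - map_mx f A *t C) = \prod_(a <- s) \det (D - f a *: C).
Proof.
elim: s n A => [|a s IHs] [|n] A charA m C D.
- by rewrite big_nil det_mx00.
- by have := size_char_poly A; rewrite charA big_nil size_poly1.
- by have := size_char_poly A; rewrite charA size_prod_XsubC.
have [|Q [u [B [Qu QA]]]] := @root_char_poly_block _ _ A a.
  by rewrite charA root_prod_XsubC mem_head.
have charB : char_poly B = \prod_(b <- s) ('X - b%:P).
  apply: (@mulfI _ ('X - a%:P)); first by rewrite polyXsubC_eq0.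
  rewrite -(big_cons _ _ a s xpredT) -charA.
  rewrite (char_poly_similar (mulmxV Qu) QA).
  have <- : char_poly (a%:M : 'M_1) = 'X - a%:P.
    by rewrite /char_poly det_mx11 !mxE !eqxx.
  by rewrite -(char_poly_lblock _ u).
(* Q * 1 conjugates the pencil of A to that of its block triangular form. *)
rewrite big_cons -(IHs _ _ charB) -(det_tens_lblock _ (map_mx f u)).
apply: (@det_similar _ _ (map_mx f Q *t 1%:M) (map_mx f (invmx Q) *t 1%:M)).
  by rewrite tensmx_mul -map_mxM mulmxV // map_mx1 mulmx1 tens1_scalar.
rewrite mulmxBr mulmxBl !tensmx_mul !mulmx1 !mul1mx -map_mxM QA.
by rewrite -(map_scalar_mx f) -(map_mx0 f) -map_block_mx map_mxM.
Qed.

(** Applied to the 1 x 1 matrices C = (a) and D = (X), the splitting lemma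
gives this without a separate treatment of a = 0. *)
Lemma char_poly_scale_mx (F : fieldType) m (B : 'M[F]_m) (t : seq F) (a : F) :
  char_poly B = \prod_(b <- t) ('X - b%:P) ->
  char_poly (a *: B) = \prod_(b <- t) ('X - (a * b)%:P).
Proof.
move=> charB.
have := det_tens_split polyC charB a%:P%:M ('X%:M : 'M_1).
rewrite !tens_mx_scalar det_castmxB scalemx1 -map_mxZ /char_poly => ->.
by apply: eq_bigr => b _; rewrite det_mx11 !mxE !mulr1n mulrC polyCM.
Qed.

Lemma char_poly_tens (F : fieldType) n m (A : 'M[F]_n) (B : 'M[F]_m)
    (s t : seq F) :
  char_poly A = \prod_(a <- s) ('X - a%:P) ->
  char_poly B = \prod_(b <- t) ('X - b%:P) ->
  char_poly (A *t B) = \prod_(a <- s) \prod_(b <- t) ('X - (a * b)%:P).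
Proof.
move=> charA charB.
rewrite /char_poly /char_poly_mx map_mxT -tens1_scalar.
rewrite (det_tens_split polyC charA); apply: eq_bigr => a _.
by rewrite -map_mxZ -(char_poly_scale_mx a charB).
Qed.

(** * Characteristic polynomials of bipartite block matrices *)
Section BlockScalar.
Variables (R : comNzRingType) (m n : nat).
Variables (x y : R) (Z : 'M[R]_(m, n)) (W : 'M[R]_(n, m)).

(** A Schur complement formula free of division: right multiplication by a
block lower triangular matrix with diagonal y, 1 clears the lower left
block. *)
Lemma det_block_scalarl :
  \det (block_mx x%:M Z W y%:M) * y ^+ m = \det ((x * y)%:M - Z *m W) * y ^+ n.
Proof.
have := det_mulmx (block_mx x%:M Z W y%:M) (block_mx y%:M 0 (- W) 1%:M).
rewrite det_lblock !det_scalar expr1n mulr1 => <-.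
rewrite mulmx_block !mulmx0 !mulmx1 !add0r mulmxN -scalar_mxM.
rewrite scalar_mxC mulmxN subrr det_ublock det_scalar.
by [].
Qed.

(** The other elimination: the upper right block is cleared instead. *)
Lemma det_block_scalarr :
  \det (block_mx x%:M Z W y%:M) * x ^+ n = x ^+ m * \det ((x * y)%:M - W *m Z).
Proof.
have := det_mulmx (block_mx x%:M Z W y%:M) (block_mx 1%:M (- Z) 0 x%:M).
rewrite det_ublock !det_scalar expr1n mul1r => <-.
rewrite mulmx_block !mulmx0 !mulmx1 !addr0 !mulmxN -scalar_mxM.
rewrite scalar_mxC addNr det_lblock det_scalar.
by rewrite addrC [y * x]mulrC.
Qed.

End BlockScalar.

(** Sylvester's determinant identity, by computing the determinant of the
block matrix with blocks y, Z, W, 1 in two ways. *)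
Lemma det_scalar_sub_mulC (R : comNzRingType) m n (y : R)
    (Z : 'M[R]_(m, n)) (W : 'M[R]_(n, m)) :
  \det (y%:M - Z *m W) * y ^+ n = y ^+ m * \det (y%:M - W *m Z).
Proof.
have := det_block_scalarl y 1 Z W; have := det_block_scalarr y 1 Z W.
by rewrite !expr1n !mulr1 => <- ->.
Qed.

Lemma char_poly_bip (R : comNzRingType) m n (Z : 'M[R]_(m, n)) :
  char_poly (block_mx 0 Z Z^T 0) * 'X^m =
  \det (('X^2)%:M - map_mx polyC (Z *m Z^T)) * 'X^n.
Proof.
rewrite /char_poly /char_poly_mx map_block_mx !map_mx0 scalar_mx_block.
rewrite opp_block_mx add_block_mx !subr0 !sub0r det_block_scalarl.
by rewrite mulmxN mulNmx opprK map_mxM expr2.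
Qed.

(** The ratio identity in terms of matrices, with the powers of X distributed
over both sides so that no exponent is negative. *)
Lemma char_poly_bip_tens_swap (R : idomainType) p q r s
    (M : 'M[R]_(p, q)) (N : 'M[R]_(r, s)) :
  char_poly (block_mx 0 (M *t N) (M *t N)^T 0) * 'X^(p * s + q * r) =
  'X^(p * r + q * s) * char_poly (block_mx 0 (M *t N^T) (M *t N^T)^T 0).
Proof.
have hE := char_poly_bip (M *t N); have hO := char_poly_bip (M *t N^T).
(* Z W and W Z are the Gram matrices of M * N and of M * N^T. *)
pose Z := map_mx polyC ((M *m M^T) *t N).
pose W := map_mx polyC ((1%:M : 'M_p) *t N^T).
have hS := det_scalar_sub_mulC 'X^2 Z W.
rewrite /Z /W -!map_mxM !tensmx_mul !mulmx1 !mul1mx in hS.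
rewrite !trmx_tens !tensmx_mul trmxK in hE hO *.
set PE := char_poly _ in hE *; set PO := char_poly _ in hO *.
move: hE hO hS; set d1 := \det _; set d2 := \det _ => hE hO hS.
(* The three relations multiply up to the claim times this power of X: it
   collects the factors carried by the left-hand sides of hE and hO. *)
apply: (@mulIf _ 'X^(p * r + p * s)); first by rewrite expf_neq0 ?polyX_eq0.
rewrite -!exprM !mul2n -!addnn !exprD in hS; rewrite !exprD.
move: hE hO hS; move: ('X^(p * r)) ('X^(p * s)) ('X^(q * r)) ('X^(q * s)).
move=> Xpr Xps Xqr Xqs hE hO hS.
transitivity ((PE * Xpr) * (Xps * Xps * Xqr)); first by ring.
rewrite hE; transitivity ((d1 * (Xps * Xps)) * (Xqs * Xqr)); first by ring.
rewrite hS; transitivity ((d2 * Xqr) * (Xpr * Xpr * Xqs)); first by ring.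
by rewrite -hO; ring.
Qed.

(** * Graph polynomials from enumerations of the vertices *)
Lemma char_poly_perm (R : comNzRingType) n (A : 'M[R]_n) (s : 'S_n) :
  char_poly (\matrix_(i, j) A (s i) (s j)) = char_poly A.
Proof.
apply/esym/(@char_poly_similar _ _ (perm_mx s) (perm_mx s^-1)).
  by rewrite -perm_mxM mulgV perm_mx1.
have -> : \matrix_(i, j) A (s i) (s j) = row_perm s (col_perm s A).
  by apply/matrixP => i j; rewrite !mxE.
by rewrite row_permE col_permE -!mulmxA -perm_mxM mulVg perm_mx1 mulmx1.
Qed.

(** The matrix of a graph depends on an ordering of the vertices. Enumerations
other than the canonical one are needed to see the even subgraph in block form
and the weak product as a Kronecker product. *)
Definition enumerates (T : finType) n (f : 'I_n -> T) (S : {pred T}) :=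
  injective f /\ codom f =i S.

Lemma enumerates_enum_val (T : finType) (S : {pred T}) :
  enumerates (@enum_val T S) S.
Proof.
split=> [|x]; first exact: enum_val_inj.
apply/codomP/idP => [[i ->]|xS]; first exact: enum_valP.
by exists (enum_rank_in xS x); rewrite enum_rankK_in.
Qed.

Definition glue (T : Type) m n (f : 'I_m -> T) (g : 'I_n -> T)
    (k : 'I_(m + n)) : T :=
  match split k with inl i => f i | inr j => g j end.

Lemma glue_lshift (T : Type) m n (f : 'I_m -> T) (g : 'I_n -> T) i :
  glue f g (lshift n i) = f i.
Proof. by rewrite /glue -[lshift n i]/(unsplit (inl i)) unsplitK. Qed.

Lemma glue_rshift (T : Type) m n (f : 'I_m -> T) (g : 'I_n -> T) j :
  glue f g (rshift m j) = g j.
Proof. by rewrite /glue -[rshift m j]/(unsplit (inr j)) unsplitK. Qed.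

Lemma enumerates_glue (T : finType) m n (f : 'I_m -> T) (g : 'I_n -> T)
    (A B : {set T}) :
  enumerates f A -> enumerates g B -> [disjoint A & B] ->
  enumerates (glue f g) (A :|: B).
Proof.
move=> [f_inj fA] [g_inj gB] dAB.
have fgN i j : f i = g j -> False.
  move=> fg; have := disjointFr dAB (x := f i).
  by rewrite -fA codom_f {1}fg -gB codom_f => /(_ isT).
split=> [k l|x].
  case: (split_ordP k) => i ->; case: (split_ordP l) => j ->;
    rewrite ?glue_lshift ?glue_rshift.
  - by move/f_inj ->.
  - by move/fgN.
  - by move/esym/fgN.
  - by move/g_inj ->.
rewrite inE -fA -gB; apply/codomP/orP => [[k ->]|].
  case: (split_ordP k) => i ->; rewrite ?glue_lshift ?glue_rshift;
    by [left; apply: codom_f | right; apply: codom_f].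
case=> /codomP [i ->].
  by exists (lshift n i); rewrite glue_lshift.
by exists (rshift m i); rewrite glue_rshift.
Qed.

(** Lists pairs in the order in which the Kronecker product indexes its rows. *)
Definition tens_fun (T U : Type) m n (f : 'I_m -> T) (g : 'I_n -> U)
    (k : 'I_(m * n)) : T * U :=
  (f (mxtens_unindex k).1, g (mxtens_unindex k).2).

Lemma enumerates_tens (T U : finType) m n (f : 'I_m -> T) (g : 'I_n -> U)
    (A : {pred T}) (B : {pred U}) :
  enumerates f A -> enumerates g B ->
  enumerates (tens_fun f g) [predX A & B].
Proof.
move=> [f_inj fA] [g_inj gB]; split=> [k l|[x y]].
  case: (mxtens_indexP k) => i j; case: (mxtens_indexP l) => i' j'.
  by rewrite /tens_fun !mxtens_indexK => -[/f_inj -> /g_inj ->].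
rewrite inE /= -fA -gB; apply/codomP/andP => [[k [-> ->]]|].
  by rewrite !codom_f.
case=> /codomP [i ->] /codomP [j ->].
by exists (mxtens_index (i, j)); rewrite /tens_fun mxtens_indexK.
Qed.

(** * Even and odd subgraphs *)
Section GraphPoly.
Variable F : comNzRingType.

Definition adj_mx (G : sgraph) m n (f : 'I_m -> G) (g : 'I_n -> G) :
    'M[F]_(m, n) :=
  \matrix_(i, j) (adj (f i) (g j))%:R.

Lemma adj_mx_tr (G : sgraph) m n (f : 'I_m -> G) (g : 'I_n -> G) :
  (adj_mx f g)^T = adj_mx g f.
Proof. by apply/matrixP => i j; rewrite !mxE adj_sym. Qed.

Lemma adj_mx_glue (G : sgraph) m1 m2 (f1 : 'I_m1 -> G) (f2 : 'I_m2 -> G) :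
  adj_mx (glue f1 f2) (glue f1 f2) =
  block_mx (adj_mx f1 f1) (adj_mx f1 f2) (adj_mx f2 f1) (adj_mx f2 f2).
Proof.
apply/matrixP => i j; rewrite !mxE.
by case: (split_ordP i) => i' ->; case: (split_ordP j) => j' ->;
  rewrite ?glue_lshift ?glue_rshift !(row_mxEl, row_mxEr, mxE).
Qed.

Lemma adj_mx_tens (G H : sgraph) m n p q (f : 'I_m -> G) (f' : 'I_n -> G)
    (g : 'I_p -> H) (g' : 'I_q -> H) :
  @adj_mx (weak_product G H) _ _ (tens_fun f g) (tens_fun f' g') =
  adj_mx f f' *t adj_mx g g'.
Proof. by apply/matrixP => i j; rewrite !mxE -natrM mulnb. Qed.

Lemma graph_poly_enum (G : sgraph) n (h : 'I_n -> G) :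
  enumerates h predT -> graph_poly F G = char_poly (adj_mx h h).
Proof.
move=> [h_inj hG].
have nG : n = #|G|.
  by rewrite -[LHS]card_ord -(card_codom h_inj) (eq_card hG).
subst n.
have s_inj : injective (enum_rank \o h) by move=> i j /enum_rank_inj /h_inj.
rewrite /graph_poly -(char_poly_perm (adjacency F G) (perm s_inj)).
congr char_poly.
by apply/matrixP => i j; rewrite !mxE !permE /= !enum_rankK.
Qed.

Lemma graph_poly_induced (G : sgraph) (S : {set G}) n (f : 'I_n -> G) :
  enumerates f S -> graph_poly F (induced S) = char_poly (adj_mx f f).
Proof.
move=> [f_inj fS].
have fSP k : f k \in S by rewrite -fS codom_f.
pose h k : induced S := exist _ (f k) (fSP k).
rewrite (@graph_poly_enum _ _ h) //; split=> [k l [/f_inj]//|x].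
have := valP x; rewrite -fS => /codomP [k xE].
by apply/codomP; exists k; apply: val_inj.
Qed.

Lemma graph_poly_split (G : sgraph) (S T : {set G}) :
  S :|: T = [set: G] -> [disjoint S & T] ->
  (forall u v, u \in S -> v \in T -> ~~ adj u v) ->
  graph_poly F G = graph_poly F (induced S) * graph_poly F (induced T).
Proof.
move=> ST dST noadj.
have eS := enumerates_enum_val (mem S); have eT := enumerates_enum_val (mem T).
rewrite (@graph_poly_induced G S _ _ eS) (@graph_poly_induced G T _ _ eT).
have [e_inj eG] := enumerates_glue eS eT dST.
have -> := @graph_poly_enum G _ (glue (@enum_val _ (mem S)) (@enum_val _ (mem T))).
  rewrite adj_mx_glue [X in block_mx _ X](_ : _ = 0) ?char_poly_lblock //.
  by apply/matrixP => i j; rewrite !mxE (negbTE (noadj _ _ _ _)) ?enum_valP.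
by split=> // x; rewrite eG ST !inE.
Qed.

Lemma graph_poly_weak_product (G H : sgraph) :
  graph_poly F (weak_product G H) =
  char_poly (adjacency F G *t adjacency F H).
Proof.
have [e_inj eGH] := enumerates_tens (enumerates_enum_val G) (enumerates_enum_val H).
have -> := @graph_poly_enum (weak_product G H) _
  (tens_fun (@enum_val _ G) (@enum_val _ H)).
  by rewrite adj_mx_tens.
by split=> // x; rewrite eGH.
Qed.

Definition biadjacency (G : sgraph) (A B : {set G}) : 'M[F]_(#|A|, #|B|) :=
  adj_mx (@enum_val _ (mem A)) (@enum_val _ (mem B)).

Lemma bipartition_sym (G : sgraph) (A1 A2 : {set G}) :
  bipartition A1 A2 -> bipartition A2 A1.
Proof.
move=> [AU dA adjA]; split; rewrite 1?setUC 1?disjoint_sym //.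
by move=> u v /adjA; rewrite orbC.
Qed.

Lemma bipartition_stable (G : sgraph) (A1 A2 : {set G}) u v :
  bipartition A1 A2 -> u \in A1 -> v \in A1 -> adj u v = false.
Proof.
move=> [_ dA adjA] uA vA; apply/negP => /adjA.
by rewrite (disjointFr dA uA) (disjointFr dA vA) andbF.
Qed.

(** Listing first the pairs of first parts, then the pairs of second parts,
puts the adjacency matrix in block form; the diagonal blocks vanish because
the parts of G are stable. The lemma also serves for the odd subgraph, which is
the even one with the parts of H exchanged. *)
Lemma graph_poly_even (G H : sgraph) (A1 A2 : {set G}) (B1 B2 : {set H}) :
  bipartition A1 A2 ->
  graph_poly F (even_subgraph A1 A2 B1 B2) =
  char_poly (block_mx 0 (biadjacency A1 A2 *t biadjacency B1 B2)
                      (biadjacency A1 A2 *t biadjacency B1 B2)^T 0).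
Proof.
move=> hG; have [_ dA _] := hG.
pose f (A : {set G}) (B : {set H}) :=
  tens_fun (@enum_val _ (mem A)) (@enum_val _ (mem B)).
have ef A B : enumerates (f A B) (setX A B).
  have [f_inj fAB] := enumerates_tens (enumerates_enum_val (mem A))
                                   (enumerates_enum_val (mem B)).
  by split=> // x; rewrite fAB !inE.
have dAB : [disjoint setX A1 B1 & setX A2 B2].
  rewrite disjoints_subset; apply/subsetP => -[u v].
  by rewrite !inE /= => /andP [uA _]; rewrite (disjointFr dA uA).
have [g_inj gE] := enumerates_glue (ef A1 B1) (ef A2 B2) dAB.
have -> := @graph_poly_induced (weak_product G H) _ _
  (glue (f A1 B1) (f A2 B2)); last by split=> // w; rewrite gE !inE.
have stable0 (A B : {set G}) : bipartition A B -> biadjacency A A = 0.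
  move=> AB; apply/matrixP => i j.
  by rewrite !mxE (bipartition_stable AB) ?enum_valP.
rewrite adj_mx_glue !adj_mx_tens trmx_tens !adj_mx_tr.
by rewrite [X in block_mx (X *t _)](stable0 _ _ hG)
  [X in block_mx _ _ _ (X *t _)](stable0 _ _ (bipartition_sym hG)) !tens0mx.
Qed.

End GraphPoly.

(** An edge of the product between an even and an odd pair would project to an
edge inside a part, either in G or in H. *)
Lemma graph_poly_even_odd (F : comNzRingType) (G H : sgraph)
    (A1 A2 : {set G}) (B1 B2 : {set H}) :
  bipartition A1 A2 -> bipartition B1 B2 ->
  graph_poly F (even_subgraph A1 A2 B1 B2) *
    graph_poly F (odd_subgraph A1 A2 B1 B2) =
  graph_poly F (weak_product G H).
Proof.
move=> hG hH; have [AU dA _] := hG; have [BU dB _] := hH.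
have hG' := bipartition_sym hG; have hH' := bipartition_sym hH.
apply/esym/graph_poly_split.
- apply/setP => -[u v]; rewrite !inE /=.
  have := in_setT u; have := in_setT v; rewrite -AU -BU !inE.
  by do 4!case: (_ \in _).
- rewrite disjoints_subset; apply/subsetP => -[u v]; rewrite !inE /=.
  case/orP => /andP [uA vB].
    by rewrite (disjointFr dA uA) (disjointFr dB vB) andbF.
  by rewrite (disjointFl dA uA) (disjointFl dB vB) andbF.
move=> [u v] [u' v']; rewrite !inE /= /weak_adj /=.
case/orP => /andP [uA vB]; case/orP => /andP [uA' vB'].
- by rewrite (bipartition_stable hG).
- by rewrite (bipartition_stable hH) // andbF.
- by rewrite (bipartition_stable hH') // andbF.
- by rewrite (bipartition_stable hG').
Qed.

Lemma prod_XsubC_map (R : comNzRingType) n (ev : 'I_n -> R) :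
  \prod_(i < n) ('X - (ev i)%:P) =
  \prod_(a <- [seq ev i | i <- enum 'I_n]) ('X - a%:P).
Proof. by rewrite big_map big_enum. Qed.

Theorem theorem1 (F : numFieldType) (G H : sgraph)
    (A1 A2 : {set G}) (B1 B2 : {set H}) (p q r s : nat)
    (mu : 'I_(p + q) -> F) (lambda : 'I_(r + s) -> F)
    (hG : bipartition A1 A2) (hH : bipartition B1 B2)
    (hp : #|A1| = p) (hq : #|A2| = q) (hr : #|B1| = r) (hs : #|B2| = s)
    (hmu : eigenvalues_of (adjacency F G) mu)
    (hlambda : eigenvalues_of (adjacency F H) lambda) :
  graph_poly F (even_subgraph A1 A2 B1 B2) *
      graph_poly F (odd_subgraph A1 A2 B1 B2)
    = \prod_(j < p + q) \prod_(k < r + s) ('X - (mu j * lambda k)%:P)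
  /\
  (* in the field of rational functions, as the exponent may be negative *)
  tofrac (graph_poly F (even_subgraph A1 A2 B1 B2))
    = tofrac 'X ^ ((p%:Z - q%:Z) * (r%:Z - s%:Z))
      * tofrac (graph_poly F (odd_subgraph A1 A2 B1 B2))
      :> {fraction {poly F}}.
Proof.
split.
  rewrite graph_poly_even_odd // graph_poly_weak_product.
  rewrite /eigenvalues_of !prod_XsubC_map in hmu hlambda.
  rewrite (char_poly_tens hmu hlambda) big_map big_enum.
  by apply: eq_bigr => j _; rewrite big_map big_enum.
have evenX : graph_poly F (even_subgraph A1 A2 B1 B2) * 'X^(p * s + q * r) =
    'X^(p * r + q * s) * graph_poly F (odd_subgraph A1 A2 B1 B2).
  rewrite -[odd_subgraph A1 A2 B1 B2]/(even_subgraph A1 A2 B2 B1).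
  rewrite !graph_poly_even // -[biadjacency F B2 B1]adj_mx_tr -hp -hq -hr -hs.
  exact: char_poly_bip_tens_swap.
have X_neq0 : tofrac 'X != 0 :> {fraction {poly F}}.
  by rewrite tofrac_eq0 polyX_eq0.
apply: (mulIf (expf_neq0 (p * s + q * r) X_neq0)).
rewrite -tofracXn -tofracM evenX tofracM !tofracXn mulrAC; congr (_ * _).
rewrite [LHS]exprnP [_ ^+ _ in RHS]exprnP -expfzDr //; congr (_ ^ _).
by rewrite !PoszD !PoszM; ring.
Qed.
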